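(* For every positive integer $d$, there exists an irreducible polynomial $P\in\mathbb{Q}[x,y]$ of degree at most $d$ such that $$1\in\langle x'-1,\ y'-y,\ P(x,y)\rangle^{(\infty)}\quad\text{and}\quad 1\notin\langle x'-1,\ y'-y,\ P(x,y)\rangle^{(B-1)},$$ where $B=\binom{d+2}{2}-1=\frac{d(d+3)}{2}$.
   Context: $\mathbb{Q}$ carries the zero derivation. The ideals are in the ring of differential polynomials over $\mathbb{Q}$ in $x,y$, i.e. the polynomial ring in the algebraically independent variables $x^{(j)},y^{(j)}$ ($j\geqslant 0$) with derivation $(x^{(j)})'=x^{(j+1)}$, $(y^{(j)})'=y^{(j+1)}$; $x=x^{(0)}$, $y=y^{(0)}$. For an ideal $I$ and $h\in\mathbb{Z}_{\geqslant 0}$, $I^{(h)}$ is the ideal of this ring generated by all $a^{(j)}$ with $a\in I$, $0\leqslant j\leqslant h$; $I^{(\infty)}$ is the differential ideal generated by $I$. $\langle a_1,\ldots,a_n\rangle$ is the ideal generated by $a_1,\ldots,a_n$. *)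

(* Defs.v *)
From HB Require Import structures.
From mathcomp Require Import all_boot all_order all_algebra finmap zify ring.
(* [monalg] and [mpoly] share many names; [mpoly] is imported last and wins,
   except for the notation {mpoly R[n]}, written [mpoly n R] here. *)
From mathcomp Require Import monalg.
From mathcomp Require Import mpoly.

Set Implicit Arguments.
Unset Strict Implicit.
Unset Printing Implicit Defensive.

Import GRing.Theory.
Local Open Scope ring_scope.

(* (i, j) stands for the j-th derivative of the i-th differential
   indeterminate; i = 0 is x and i = 1 is y. *)
Notation dvar := ('I_2 * nat)%type.
Notation dmonom := {cmonom dvar}.
(* The constants R carry the zero derivation, so that [der] is R-linear. *)
Notation diffpoly R := {malg R[dmonom]}.

Lemma leibniz_aux1 (S : comNzRingType) (A B D x y : S) :
  A * y * D + B * x * D = A * D * y + x * (B * D).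
Proof. by ring. Qed.

Lemma leibniz_aux2 (S : comNzRingType) (C E M N x y dp dq p q : S) :
  dp = C * M -> dq = E * N -> p = C * x -> q = E * y ->
  C * E * (M * y + x * N) = dp * q + p * dq.
Proof. by move=> -> -> -> ->; ring. Qed.

Lemma leibniz_sum (I : Type) (S : comNzRingType) (D : S -> S) (s t : seq I) (F G : I -> S) :
  (forall (u : seq I) (H : I -> S), D (\sum_(i <- u) H i) = \sum_(i <- u) D (H i)) ->
  (forall i j, D (F i * G j) = D (F i) * G j + F i * D (G j)) ->
  let p := \sum_(i <- s) F i in let q := \sum_(j <- t) G j in
  D (p * q) = D p * q + p * D q.
Proof.
move=> Ds DM /=; rewrite mulr_suml !Ds !mulr_suml -big_split; apply: eq_bigr => i _.
rewrite !mulr_sumr Ds -big_split; apply: eq_bigr => j _; exact: DM.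
Qed.

Section DifferentialPolynomials.
Variable R : comNzRingType.
Implicit Types (p q : diffpoly R) (m n : dmonom).

Definition dX (i : 'I_2) (j : nat) : diffpoly R := mkmalgU (ucm (i, j)) 1.

(* The truncated division [divcm] of monomials is exact here: v divides m. *)
Definition derm (m : dmonom) : diffpoly R :=
  \sum_(v <- finsupp m) mkmalgU (divcm m (ucm v)) (m v)%:R * dX v.1 v.2.+1.

Definition der : diffpoly R -> diffpoly R := monalg.mmap (@mkmalgU _ R mone) derm.

HB.instance Definition _ := GRing.Additive.on der.

Lemma der_monom (c : R) m : der (mkmalgU m c) = mkmalgU mone c * derm m.
Proof. exact: monalg.mmapU. Qed.

Lemma derm1 : derm mone = 0.
Proof. by rewrite /derm mdom1 big_seq_fset0. Qed.

Lemma der_const (c : R) : der (mkmalgU mone c) = 0.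
Proof. by rewrite der_monom derm1 mulr0. Qed.

Lemma mkmalgM m n (c e : R) :
  (mkmalgU m c : diffpoly R) * mkmalgU n e = mkmalgU (mmul m n) (c * e).
Proof. by rewrite malgM_def fgmulUU. Qed.

Lemma dermEw (d : {fset dvar}) m : fsubset (finsupp m) d ->
  derm m = \sum_(v <- d) mkmalgU (divcm m (ucm v)) (m v)%:R * dX v.1 v.2.+1.
Proof.
move=> sd; rewrite /derm (big_fset_incl _ sd) // => v _.
rewrite -cmE_eq0 => /eqP ->; rewrite mulr0n.
by rewrite monalgU0 mul0r.
Qed.

Lemma divcm_mul m n v : m v != 0%N ->
  divcm (mmul m n) (ucm v) = mmul (divcm m (ucm v)) n.
Proof.
move=> mv; apply/eqP/cmP => w; rewrite !(divcmE, cmM, ucmE).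
by have [<-|_] := eqVneq v w; lia.
Qed.

Lemma dermM m n : derm (mmul m n) = derm m * mkmalgU n 1 + mkmalgU m 1 * derm n.
Proof.
set d := fsetU (finsupp m) (finsupp n).
rewrite (@dermEw d m) ?fsubsetUl // (@dermEw d n) ?fsubsetUr //.
rewrite (@dermEw d (mmul m n)); last by rewrite (mdomD m n) fsubset_refl.
rewrite [X in _ = X + _]mulr_suml [X in _ = _ + X]mulr_sumr -big_split /=.
apply: eq_bigr => v _.
have half k l : mkmalgU (divcm (mmul k l) (ucm v)) (k v)%:R
    = mkmalgU (divcm k (ucm v)) (k v)%:R * mkmalgU l 1 :> diffpoly R.
  rewrite mkmalgM mulr1; have [->|kv] := eqVneq (k v) 0%N.
    by rewrite mulr0n !monalgU0.
  by rewrite divcm_mul.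
rewrite cmM natrD monalgUD [LHS]mulrDl half.
rewrite [mmul m n]mulmC half.
exact: leibniz_aux1.
Qed.

Lemma derM p q : der (p * q) = der p * q + p * der q.
Proof.
have derU m n (c e : R) :
    der (mkmalgU m c * mkmalgU n e)
    = der (mkmalgU m c) * mkmalgU n e + mkmalgU m c * der (mkmalgU n e).
  have split k a : mkmalgU k a = mkmalgU mone a * mkmalgU k 1 :> diffpoly R.
    by rewrite mkmalgM mul1m mulr1.
  transitivity (mkmalgU mone c * mkmalgU mone e * (derm m * mkmalgU n 1 + mkmalgU m 1 * derm n)).
    have CC : mkmalgU mone (c * e) = mkmalgU mone c * mkmalgU mone e :> diffpoly R.
      by rewrite mkmalgM mul1m.
    apply: etrans (congr1 der (mkmalgM m n c e)) _.
    exact: etrans (der_monom _ _) (congr2 *%R CC (dermM m n)).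
  apply: leibniz_aux2; [exact: der_monom|exact: der_monom|exact: split|exact: split].
have sumE r : exists s (F : dmonom -> R), r = \sum_(m <- s) mkmalgU m (F m).
  exists (monalg.msupp r), (fun m => monalg.mcoeff m r); exact: monalgE.
have [s [F ->]] := sumE p; have [t [G ->]] := sumE q.
have sumd u (H : dmonom -> diffpoly R) :
    der (\sum_(m <- u) H m) = \sum_(m <- u) der (H m) by exact: raddf_sum.
exact: leibniz_sum.
Qed.

Lemma der_dX (i : 'I_2) (j : nat) : der (dX i j) = dX i j.+1.
Proof.
have U1 : mkmalgU mone 1 = 1 :> diffpoly R by exact: monalg.mpolyC1E.
apply: etrans (der_monom _ _) _; rewrite /derm mdomU big_seq_fset1 ucmE eqxx U1.
have -> : divcm (ucm (i, j)) (ucm (i, j)) = mone :> dmonom.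
  by apply/eqP/cmP => w; rewrite divcmE cm1 subnn.
by apply: etrans (mul1r _) _; rewrite mulr1n U1; exact: mul1r.
Qed.

End DifferentialPolynomials.

Arguments der {R} p.

Definition generated_ideal (R : comNzRingType) (S : R -> Prop) (p : R) : Prop :=
  exists2 s : seq (R * R),
    (forall c, c \in s -> S c.2) & p = \sum_(c <- s) c.1 * c.2.

Definition ideal_of_seq (R : comNzRingType) (s : seq R) : R -> Prop :=
  generated_ideal (fun a => a \in s).

Definition prolonged_ideal (h : nat) (I : diffpoly rat -> Prop) : diffpoly rat -> Prop :=
  generated_ideal (fun b => exists a j, [/\ I a, (j <= h)%N & b = iter j der a]).

Definition differential_ideal (J : diffpoly rat -> Prop) : Prop :=
  [/\ J 0, forall a b, J a -> J b -> J (a + b),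
      forall a b, J b -> J (a * b) & forall a, J a -> J (der a)].

Definition generated_differential_ideal (I : diffpoly rat -> Prop) (p : diffpoly rat) :
    Prop :=
  forall J, differential_ideal J -> (forall a, I a -> J a) -> J p.

Definition irreducible_elt (R : idomainType) (p : R) : Prop :=
  [/\ p != 0, p \isn't a GRing.unit
    & forall a b, p = a * b -> a \is a GRing.unit \/ b \is a GRing.unit].

Definition to_diffpoly (P : mpoly 2 rat) : diffpoly rat :=
  mmap (in_alg (diffpoly rat)) (fun i => dX rat i 0) P.

Notation x_ j := (dX rat ord0 j).
Notation y_ j := (dX rat ord_max j).

Lemma binomial_bound (d : nat) : (2 * ('C(d + 2, 2) - 1) = d * (d + 3))%N.
Proof. by rewrite mulnBr -mul_bin_diag bin1; lia. Qed.

(* Main.v *)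
(* Modulo x' - 1 and y' - y, the derivation acts on Q[x, y] as the operator
   L = d/dx + y d/dy, which preserves the (B+1)-dimensional space of polynomials
   of degree at most d.  By linear algebra there is P <> 0 in it with
   (L^j P)(0, 1) = 0 for j < B, i.e. P(t, e^t) vanishes to order B at t = 0;
   evaluating at (0, 1) shows 1 is not in the prolongation of order B - 1.

   On polynomials sum_k q_k(x) y^k, the operator L - k lowers the degree of q_k
   and does not raise the other ones.  Hence a suitable product of B operators
   L - k sends P to a constant, which is nonzero by the vanishing conditions, so
   1 is a combination of the L^j P.  The same descent shows that a nonzero
   polynomial of degree at most e vanishes to order at most e(e+3)/2 along
   (t, e^t); since this bound is strictly superadditive in e, P is irreducible. *)

From HB Require Import structures.
Require Import Defs.
From mathcomp Require Import all_boot all_order all_algebra finmap.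
From mathcomp Require Import zify ring.
From mathcomp Require Import monalg.
From mathcomp Require Import mpoly.

Set Implicit Arguments.
Unset Strict Implicit.
Unset Printing Implicit Defensive.

Import GRing.Theory Num.Theory.
Local Open Scope ring_scope.

(** * Monomials in two variables *)

Lemma mnm_subnn n (m : 'X_{1..n}) : (m - m = 0)%MM.
Proof. by apply/mnmP => i; rewrite mnmBE subnn mnm0E. Qed.

Lemma ord2P (i : 'I_2) : i = ord0 \/ i = ord_max.
Proof. by case: i => [[|[|]]] // lt_i; [left|right]; apply: val_inj. Qed.

Lemma mnm2P (m1 m2 : 'X_{1..2}) :
  m1 ord0 = m2 ord0 -> m1 ord_max = m2 ord_max -> m1 = m2.
Proof.
by move=> e0 e1; apply/mnmP => i; case: (ord2P i) => ->.
Qed.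

Lemma mdeg2 (m : 'X_{1..2}) : mdeg m = (m ord0 + m ord_max)%N.
Proof.
rewrite mdegE big_ord_recl big_ord1; congr (_ + m _)%N; exact: val_inj.
Qed.

(** * The operator L = d/dx + y d/dy and vanishing at (0, 1) *)

Section LieDerivative.
Variable R : comNzRingType.
Implicit Types Q T : mpoly 2 R.

Definition lieD (Q : mpoly 2 R) : mpoly 2 R :=
  Q^`M(ord0) + Q^`M(ord_max) * 'X_ord_max.

Lemma lieD_is_linear : linear lieD.
Proof.
by move=> c Q T; rewrite /lieD !linearP /= mulrDl scalerDr -scalerAl addrACA.
Qed.

HB.instance Definition _ :=
  GRing.isLinear.Build R (mpoly 2 R) (mpoly 2 R) _ lieD lieD_is_linear.

Lemma lieDD Q T : lieD (Q + T) = lieD Q + lieD T.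
Proof. exact: linearD. Qed.

Lemma lieDM Q T : lieD (Q * T) = lieD Q * T + Q * lieD T.
Proof. by rewrite /lieD !mderivM; ring. Qed.

Lemma mcoeff_lieD Q m :
  (lieD Q)@_m = Q@_(m + U_(ord0)) *+ (m ord0).+1 + Q@_m *+ m ord_max.
Proof.
rewrite /lieD mcoeffD mcoeff_deriv; congr (_ + _).
(* A monomial not divisible by y does not occur in the second summand of [lieD]; otherwise one
   factor y can be split off. *)
have [m0|m_gt0] := posnP (m ord_max).
  rewrite m0 mulr0n; apply: memN_msupp_eq0; rewrite (perm_mem (msuppMX _ _)).
  apply/mapP => -[k _ /mnmP /(_ ord_max)].
  by rewrite m0 !mnmE eqxx.
have e : (m = U_(ord_max) + (m - U_(ord_max)))%MM.
  by rewrite addmC submK // lep1mP -lt0n.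
by rewrite {1}e mcoeffMX mcoeff_deriv addmC -e !mnmE eqxx subn1 prednK.
Qed.

(* (0, 1) is the point at t = 0 of the trajectory (t, e^t) of the vector field. *)
Definition evp : mpoly 2 R -> R := meval (fun i : 'I_2 => (i : nat)%:R).

Definition vanishes (n : nat) (Q : mpoly 2 R) :=
  forall j, (j < n)%N -> evp (iter j lieD Q) = 0.

(* In Q = sum_k q_k(x) y^k, each q_k has degree less than the number of
   occurrences of k in s. *)
Definition supported (s : seq nat) (Q : mpoly 2 R) :=
  forall m : 'X_{1..2}, (count_mem (m ord_max) s <= m ord0)%N -> Q@_m = 0.

Lemma iter_lieDB n Q T c :
  iter n lieD (Q - c *: T) = iter n lieD Q - c *: iter n lieD T.
Proof. by elim: n => //= n ->; rewrite linearB linearZ. Qed.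

Lemma evpB Q T : evp (Q - T) = evp Q - evp T.
Proof. exact: mevalB. Qed.

Lemma evpZ c Q : evp (c *: Q) = c * evp Q.
Proof. exact: mevalZ. Qed.

Lemma evpM Q T : evp (Q * T) = evp Q * evp T.
Proof. exact: mevalM. Qed.

Lemma vanishes_shift n c Q :
  vanishes n.+1 Q -> vanishes n (lieD Q - c *: Q).
Proof.
move=> vQ j jn; rewrite iter_lieDB -iterSr evpB evpZ !vQ ?mulr0 ?subr0 //.
exact: leqW.
Qed.

Lemma lieD_leibniz n Q T :
  iter n lieD (Q * T)
  = \sum_(i < n.+1) (iter i lieD Q * iter (n - i) lieD T) *+ 'C(n, i).
Proof.
elim: n => [|n IHn]; first by rewrite big_ord1.
rewrite [LHS]/= IHn raddf_sum.
under eq_bigr => i _ do rewrite raddfMn /= lieDM mulrnDl.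
rewrite big_split /= addrC [RHS]big_ord_recl /=.
under [X in _ = _ + X]eq_bigr => i _.
  rewrite /bump /= add1n add0n subSS binS mulrnDr; over.
rewrite big_split /= addrA; congr (_ + _).
rewrite big_ord_recl [X in _ = _ + X]big_ord_recr /= (bin_small (leqnn _)) mulr0n addr0.
rewrite !bin0 !subn0; congr (_ + _); apply: eq_bigr => i _.
rewrite /bump /= add0n add1n.
by have -> : (n - i = (n - i.+1).+1)%N by rewrite -subSn ?subSS.
Qed.

Lemma vanishesMl n Q T : vanishes n Q -> vanishes n (T * Q).
Proof.
move=> vQ j jn; rewrite lieD_leibniz /evp raddf_sum big1 // => i _.
rewrite raddfMn /= -/(evp _) evpM vQ ?mulr0 ?mul0rn //.
by rewrite (leq_ltn_trans _ jn) ?leq_subr.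
Qed.

(** In the Leibniz sum only the term i = a survives: below it the factor from Q is 0 at the point,
    above it the one from T. Over a field of characteristic 0, orders of vanishing therefore add. *)
Lemma evp_leibniz_min a b Q T : vanishes a Q -> vanishes b T ->
  evp (iter (a + b) lieD (Q * T))
  = (evp (iter a lieD Q) * evp (iter b lieD T)) *+ 'C(a + b, a).
Proof.
move=> vQ vT; have lt_a : (a < (a + b).+1)%N by rewrite ltnS leq_addr.
rewrite lieD_leibniz /evp raddf_sum (bigD1 (Ordinal lt_a)) //=.
rewrite big1 ?addr0 => [|i ia]; rewrite raddfMn /= -/(evp _) evpM.
  by rewrite addKn.
have [lt_ia|lt_ai|eq_ia] := ltngtP i a.
- by rewrite vQ // mul0r mul0rn.
- by rewrite vT ?mulr0 ?mul0rn //; have := ltn_ord i; lia.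
- by case/eqP: ia; apply: val_inj.
Qed.

End LieDerivative.

(** * The zero estimate and the descent to constants *)

Section ZeroEstimate.
Variable R : numFieldType.
Implicit Types Q T : mpoly 2 R.

Lemma supported_shift k s Q :
  supported (k :: s) Q -> supported s (lieD Q - k%:R *: Q).
Proof.
move=> sQ m ms; rewrite mcoeffB mcoeffZ mcoeff_lieD sQ /=; last first.
  by rewrite !mnmE /= addn0 addn1; apply: (leq_add (leq_b1 _) ms).
rewrite mul0rn add0r mulr_natl; have [->|km] := eqVneq (m ord_max) k.
  by rewrite subrr.
by rewrite sQ ?mul0rn ?subrr //= eq_sym (negbTE km).
Qed.

(** A polynomial eigenvector of L for k is a multiple of y^k, and y^k takes the value 1 at (0,
    1). *)
Lemma eigen_eq0 k Q : lieD Q = k%:R *: Q -> evp Q = 0 -> Q = 0.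
Proof.
move=> LQ Q0.
have rec m : Q@_(m + U_(ord0)) *+ (m ord0).+1 + Q@_m *+ m ord_max = Q@_m *+ k.
  by rewrite -mcoeff_lieD LQ mcoeffZ mulr_natl.
(* Downward induction on the degree of m. Once the coefficient at x m is 0, [rec] leaves (l - k) Q_m
   = 0, where l is the exponent of y, and l - k is nonzero in characteristic 0. *)
have off n (m : 'X_{1..2}) : (msize Q <= mdeg m + n)%N -> m ord_max != k -> Q@_m = 0.
  elim: n m => [|n IHn] m sz mk.
    by apply/memN_msupp_eq0/msize_mdeg_ge; rewrite addn0 in sz.
  have := rec m; rewrite IHn ?mnmE /= ?addn0 //; last by rewrite mdegD mdeg1; lia.
  rewrite mul0rn add0r => /eqP.
  rewrite -subr_eq0 -(mulr_natr _ k) -(mulr_natr _ (m ord_max)) -mulrBr.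
  rewrite mulf_eq0 => /orP[/eqP //|].
  by rewrite subr_eq0 eqr_nat (negbTE mk).
have QE : Q = Q@_(U_(ord_max) *+ k) *: 'X_[(U_(ord_max) *+ k)%MM].
  apply/mpolyP => m; rewrite mcoeffZ mcoeffX; case: eqP => [<-|km].
    by rewrite mulr1.
  rewrite mulr0; have [mk|mk] := eqVneq (m ord_max) k; last first.
    by apply: (off (msize Q)) => //; rewrite leq_addl.
  have m0 : (0 < m ord0)%N.
    rewrite lt0n; apply/eqP => m0; apply: km.
    by apply: mnm2P; rewrite mulmnE mnm1E /= ?m0 ?mk ?mul0n ?mul1n ?muln1.
  have e : (m = m - U_(ord0) + U_(ord0))%MM by rewrite submK // lep1mP -lt0n.
  (* In [rec] at m / x the terms in k cancel, leaving a positive multiple of the coefficient of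
     m. *)
  have := rec (m - U_(ord0))%MM; rewrite -e !mnmE /= subn0 mk.
  rewrite -[X in _ = X]add0r => /addIr /eqP.
  by rewrite mulrn_eq0 /= => /eqP.
have : evp Q = Q@_(U_(ord_max) *+ k).
  rewrite {1}QE /evp mevalZ mevalX big_ord_recl big_ord1 /= !mulmnE !mnm1E /=.
  by rewrite mul0n expr0 expr1n !mulr1.
by rewrite Q0 => c0; rewrite QE -c0 scale0r.
Qed.

(** Each [k] in [s] uses up one vanishing condition: (L - k) Q is 0 by induction, so Q is an
    eigenvector and [eigen_eq0] applies. *)
Lemma zero_estimate s Q : supported s Q -> vanishes (size s) Q -> Q = 0.
Proof.
elim: s Q => [|k s IHs] Q sQ vQ.
  by apply/mpolyP => m; rewrite mcoeff0 sQ.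
apply: (@eigen_eq0 k); last exact: (vQ 0%N).
apply/eqP; rewrite -subr_eq0; apply/eqP/IHs.
  exact: supported_shift.
exact: vanishes_shift.
Qed.

(** [W] stands for the preimage of a differential ideal under [to_diffpoly]. Each L - k stays in [W]
    and, by [eigen_eq0], does not kill Q while a vanishing condition is left; a nonzero constant
    remains. *)
Lemma one_in_stable (W : mpoly 2 R -> Prop) s Q :
    (forall T, W T -> W (lieD T)) ->
    (forall c T1 T2, W T1 -> W T2 -> W (c *: T1 + T2)) ->
  supported (rcons s 0%N) Q -> vanishes (size s) Q -> Q != 0 -> W Q -> W 1.
Proof.
move=> WD Wlin; elim: s Q => [|k s IHs] Q sQ vQ Q0 WQ.
  have QE : Q = (Q@_0)%:MP.
    apply/mpolyP => m; rewrite mcoeffC; case: eqP => [<-|m0].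
      by rewrite mulr1.
    rewrite mulr0 sQ //= addn0; case: eqP => //= m1.
    rewrite lt0n; apply/eqP => m0'; apply: m0.
    by apply: mnm2P; rewrite mnm0E.
  have c0 : Q@_0 != 0 by apply: contraNneq Q0 => c0; rewrite QE c0.
  (* The last summand is 0, written so that its membership in [W] follows from [Wlin]. *)
  have -> : 1 = (Q@_0)^-1 *: Q + (-1 *: Q + Q).
    by rewrite scaleN1r addNr addr0 {2}QE -mul_mpolyC -mpolyCM mulVf.
  by do 2!apply: (Wlin) => //.
apply: (IHs (lieD Q - k%:R *: Q)).
- exact: supported_shift.
- exact: vanishes_shift.
- apply: contraNneq Q0 => /eqP; rewrite subr_eq0 => /eqP /eigen_eq0 -> //.
  exact: (vQ 0%N).
- by rewrite addrC -scaleNr; apply: Wlin => //; apply: WD.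
Qed.

(* [rcons (mult_seq d) 0] contains each k <= d exactly d + 1 - k times, so it
   encodes the supports of degree at most d; 0 is kept last because the descent
   to constants must stop there. *)
Fixpoint mult_seq (d : nat) : seq nat :=
  if d is e.+1 then iota 0 d.+1 ++ mult_seq e else [::].

Lemma size_mult_seq d : (size (mult_seq d) * 2 = d * (d + 3))%N.
Proof. by elim: d => //= d; rewrite size_cat size_iota; lia. Qed.

Lemma count_mult_seq d k : count_mem k (rcons (mult_seq d) 0%N) = (d.+1 - k)%N.
Proof.
elim: d => [|d IHd]; first by case: k => [|[|]].
rewrite [mult_seq _]/= -[_ :: _]/(iota 0 d.+2 ++ mult_seq d) rcons_cat count_cat IHd.
rewrite count_uniq_mem ?iota_uniq // mem_iota; lia.
Qed.

Lemma supported_mult_seq d Q :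
  (msize Q <= d.+1)%N -> supported (rcons (mult_seq d) 0%N) Q.
Proof.
move=> Qd m; rewrite count_mult_seq => le_m.
apply/memN_msupp_eq0/msize_mdeg_ge; apply: leq_trans Qd _.
by rewrite mdeg2; lia.
Qed.

(** * Order of vanishing and irreducibility *)

Lemma vanishing_order d Q : Q != 0 -> (msize Q <= d.+1)%N ->
  exists2 n, vanishes n Q & evp (iter n (@lieD R) Q) != 0 /\ (n <= size (mult_seq d))%N.
Proof.
move=> Q0 Qd; have [/existsP exn|] := boolP
    [exists n : 'I_(size (mult_seq d)).+1, evp (iter n (@lieD R) Q) != 0].
  have ex : exists n, evp (iter n (@lieD R) Q) != 0.
    by case: exn => n nz; exists n.
  case: (ex_minnP ex) => n nz min_n; exists n => [j jn|].
    by apply/eqP/negPn/negP => /min_n; rewrite leqNgt jn.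
  split=> //; case: exn => k /min_n /leq_trans; apply.
  by rewrite -ltnS ltn_ord.
(* Orders 0 to [size (mult_seq d)] give one condition more than that size, exactly the length of
   [rcons (mult_seq d) 0]. *)
rewrite negb_exists => /forallP van; case/eqP: Q0.
apply: (zero_estimate (supported_mult_seq Qd)) => j; rewrite size_rcons => jn.
by have := van (Ordinal jn); rewrite negbK => /eqP.
Qed.

Lemma mpoly_unit_msize Q : msize Q = 1%N -> Q \is a GRing.unit.
Proof.
move=> Q1; have QE := msize1_polyC (eq_leq Q1).
have c0 : Q@_0 != 0 by apply/eqP => c0; move: Q1; rewrite QE c0 mpolyC0 msize0.
by rewrite unfold_in /= /mpoly_unit -QE eqxx unitfE.
Qed.

Lemma irreducible_of_vanishing d Q :
    (0 < d)%N -> Q != 0 -> (msize Q <= d.+1)%N ->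
  vanishes (size (mult_seq d)) Q -> irreducible_elt Q.
Proof.
move=> d0 Q0 Qd vQ; have szd := size_mult_seq d; split=> // [|A T QE].
  (* If Q were a unit, Q^-1 Q = 1 would be 0 at (0, 1), since d > 0 leaves at least one
     condition. *)
  apply/negP => uQ; have /(vanishesMl (Q^-1)) v1 := vQ.
  rewrite mulVr // in v1; have /eqP := v1 0%N ltac:(lia).
  by rewrite /evp /= meval1 oner_eq0.
have [A0 T0] : A != 0 /\ T != 0.
  by apply/andP; rewrite -negb_or -mulf_eq0 -QE.
have A1 := mpolySpred _ A0; have T1 := mpolySpred _ T0.
have szQ : msize Q = (msize A + msize T).-1 by rewrite QE msizeM.
have [uA|uA] := eqVneq (msize A) 1%N; first by left; apply: mpoly_unit_msize.
have [uT|uT] := eqVneq (msize T) 1%N; first by right; apply: mpoly_unit_msize.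
have [a vA [nzA le_a]] := vanishing_order A0 (leqSpred _).
have [b vT [nzT le_b]] := vanishing_order T0 (leqSpred _).
have sza := size_mult_seq (msize A).-1; have szb := size_mult_seq (msize T).-1.
exfalso; have: evp (iter (a + b) (@lieD R) Q) != 0.
  rewrite QE evp_leibniz_min // mulrn_eq0 negb_or -lt0n bin_gt0 leq_addr.
  by rewrite mulf_neq0.
rewrite vQ ?eqxx //.
move: (A1 mdeg) (T1 mdeg) szQ uA uT sza szb le_a le_b.
move: (msize A).-1 (msize T).-1 => u v -> -> szQ uA uT sza szb le_a le_b.
(* (u + v)(u + v + 3) exceeds u(u + 3) + v(v + 3) by 2uv, positive because neither factor is
   constant; so a + b is below the order to which Q vanishes. *)
have le_d : (u + v <= d)%N by lia.
have mono : ((u + v) * (u + v + 3) <= d * (d + 3))%N by apply: leq_mul; lia.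
nia.
Qed.

(** * Existence of P by a dimension count *)

Lemma exists_vanishing n d : (n < 'C(d + 2, 2))%N ->
  exists2 Q : mpoly 2 R, Q != 0 & (msize Q <= d.+1)%N /\ vanishes n Q.
Proof.
move=> nd.
(* Indexes the monomials of degree at most d: the tag is the exponent of y, the second component
   that of x. *)
pose I := {k : 'I_d.+1 & 'I_(d.+1 - k)}.
have cardI : #|{: I}| = 'C(d + 2, 2).
  rewrite card_tagged sumnE big_map big_enum /=.
  under eq_bigr => i _ do rewrite card_ord.
  rewrite addn2 -bin2_sum big_mkord (reindex_inj rev_ord_inj) [RHS]big_ord_recl.
  by apply: eq_bigr => i _; rewrite /= subKn.
pose mon (x : I) := (U_(ord0) *+ tagged x + U_(ord_max) *+ tag x)%MM : 'X_{1..2}.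
have mon0 x : mon x ord0 = tagged x.
  by rewrite mnmDE !mulmnE !mnm1E /= mul1n mul0n addn0.
have mon1 x : mon x ord_max = tag x.
  by rewrite mnmDE !mulmnE !mnm1E /= mul1n mul0n.
have mon_inj : injective mon.
  case=> [k a] [l b] e.
  have /= kl := mon1 (Tagged _ a); rewrite e mon1 in kl.
  have /= ab := mon0 (Tagged _ a); rewrite e mon0 in ab.
  by move/val_inj: kl a e ab => /= <- a _ /val_inj ->.
pose M := \matrix_(i < #|{: I}|, j < n) evp (iter j (@lieD R) 'X_[mon (enum_val i)]).
(* There are more monomials (rows) than conditions (columns), so the left kernel contains a nonzero
   coefficient vector. *)
have /rowV0Pn [v /sub_kermxP vM v0] : kermx M != 0.
  rewrite kermx_eq0 /row_free neq_ltn; apply/orP; left.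
  by rewrite (leq_ltn_trans (rank_leq_col M)) // cardI.
exists (\sum_i v 0 i *: 'X_[mon (enum_val i)]).
  apply: contraNneq v0 => Q0; apply/eqP/rowP => i; rewrite mxE.
  have := congr1 (mcoeff (mon (enum_val i))) Q0; rewrite raddf_sum mcoeff0 /=.
  rewrite (bigD1 i) //= mcoeffZ mcoeffX eqxx mulr1 big1 ?addr0 // => j ji.
  by rewrite mcoeffZ mcoeffX (inj_eq mon_inj) (inj_eq enum_val_inj) (negbTE ji) mulr0.
split.
  apply: leq_trans (msize_sum _ _ _) _; apply/bigmax_leqP => i _.
  apply: leq_trans (msizeZ_le _ _) _; rewrite msizeX mdeg2 mon0 mon1 ltnS.
  by case: (enum_val i) => -[k kd] [a ad]; move: ad => /=; lia.
move=> j jn; have /rowP/(_ (Ordinal jn)) := vM.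
rewrite !mxE => vM0; rewrite -[RHS]vM0.
have iter_sum k F : iter k (@lieD R) (\sum_(i < #|{: I}|) v 0 i *: F i)
    = \sum_(i < #|{: I}|) v 0 i *: iter k (@lieD R) (F i).
  by elim: k => //= k ->; rewrite raddf_sum; apply: eq_bigr => i _; rewrite /= linearZ.
rewrite iter_sum /evp raddf_sum; apply: eq_bigr => i _.
by rewrite /= mevalZ mxE.
Qed.

End ZeroEstimate.

(** * From differential polynomials to polynomials in x, y *)

Lemma diffpoly_ind (R : comNzRingType) (K : diffpoly R -> Prop) :
    (forall c, K (mkmalgU mone c)) ->
    (forall p q, K p -> K q -> K (p + q)) ->
    (forall p q, K p -> K q -> K (p * q)) ->
    (forall i j, K (dX R i j)) ->
  forall p, K p.
Proof.
move=> KC KD KM KX p.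
(* Induction on the degree, splitting off one variable that occurs in m. *)
have Kmon n (m : dmonom) : (monalg.mdeg m <= n)%N -> K (mkmalgU m 1).
  elim: n m => [|n IHn] m; rewrite ?leqn0 => mn.
    by have /eqP -> : m == mone by rewrite -monalg.mdeg_eq0.
  have [m0|[v]] := fset_0Vmem (finsupp m).
    have /eqP -> : m == mone; last exact: KC.
    by rewrite -monalg.mdeg_eq0 monalg.mdegE m0 big_seq_fset0.
  rewrite -cmE_neq0 => mv.
  have e : m = mmul (ucm v) (divcm m (ucm v)).
    apply/eqP/cmP => w; rewrite cmM divcmE ucmE subnKC //.
    by case: eqP => // <-; rewrite lt0n.
  rewrite e -[X in mkmalgU _ X]mulr1 -mkmalgM; apply: KM.
    by case: v {e mv} => i j; exact: KX.
  apply: IHn; have := congr1 (@monalg.mdeg _) e.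
  by rewrite monalg.mdegM monalg.mdegU; lia.
rewrite (monalgE p); elim: (monalg.msupp p : seq _) => [|m s IHs].
  by rewrite big_nil; have := KC 0; rewrite monalgU0.
rewrite big_cons; apply: KD => //.
have split c : mkmalgU m c = mkmalgU mone c * mkmalgU m 1 :> diffpoly R.
  by rewrite mkmalgM mul1m mulr1.
by rewrite split; apply: KM; [exact: KC | exact: Kmon (leqnn _)].
Qed.

Lemma derD (R : comNzRingType) (p q : diffpoly R) : der (p + q) = der p + der q.
Proof. exact: raddfD. Qed.

Section Specialisation.
Variable R : comNzRingType.

(* The quotient map of the ring of differential polynomials by the differential
   ideal generated by x' - 1 and y' - y. *)
Definition flow_var (v : dvar) : mpoly 2 R :=
  if v.1 == ord_max then 'X_ord_max
  else if v.2 is j.+1 then (j == 0%N)%:R else 'X_ord0.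

Definition flow_monom (m : dmonom) : mpoly 2 R :=
  \prod_(v <- finsupp m) flow_var v ^+ m v.

Lemma flow_monomEw (d : {fset dvar}) (m : dmonom) : fsubset (finsupp m) d ->
  flow_monom m = \prod_(v <- d) flow_var v ^+ m v.
Proof.
move=> sd; rewrite /flow_monom (big_fset_incl _ sd) // => v _.
by rewrite -cmE_eq0 => /eqP ->.
Qed.

Lemma flow_monom_is_multiplicative : mmorphism flow_monom.
Proof.
split=> [m n|]; last by rewrite /flow_monom mdom1 big_seq_fset0.
set d := fsetU (finsupp m) (finsupp n).
rewrite (@flow_monomEw d m) ?fsubsetUl // (@flow_monomEw d n) ?fsubsetUr //.
rewrite (@flow_monomEw d (mmul m n)); last by rewrite (mdomD m n) fsubset_refl.
by rewrite -big_split /=; apply: eq_bigr => v _; rewrite cmM exprD.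
Qed.

HB.instance Definition _ :=
  isMultiplicative.Build dmonom (mpoly 2 R) flow_monom flow_monom_is_multiplicative.

Definition flow : diffpoly R -> mpoly 2 R := monalg.mmap (@mpolyC 2 R) flow_monom.

HB.instance Definition _ := GRing.RMorphism.on flow.

Lemma flowC c : flow (mkmalgU mone c) = c%:MP.
Proof. exact: monalg.mmapC. Qed.

Lemma flowD p q : flow (p + q) = flow p + flow q.
Proof. exact: rmorphD. Qed.

Lemma flowM p q : flow (p * q) = flow p * flow q.
Proof. exact: rmorphM. Qed.

Lemma flowB p q : flow (p - q) = flow p - flow q.
Proof. exact: rmorphB. Qed.

Lemma flow1 : flow 1 = 1.
Proof. exact: rmorph1. Qed.

Lemma flow_dX i j : flow (dX R i j) = flow_var (i, j).
Proof.
rewrite /flow /dX monalg.mmapU /= mpolyC1 mul1r /flow_monom mdomU big_seq_fset1.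
by rewrite ucmE eqxx expr1.
Qed.

Lemma flow_var_succ i j : flow_var (i, j.+1) = lieD (flow_var (i, j)).
Proof.
rewrite /flow_var /lieD /=; case: eqP => _.
  by rewrite !mderivX !mnm1E /= scale0r add0r scale1r mnm_subnn mpolyX0 mul1r.
case: j => [|j] /=; last by rewrite -(mpolyC_nat _ _ (j == 0%N)) !mderivC !mul0r addr0.
by rewrite !mderivX !mnm1E /= scale0r mul0r scale1r mnm_subnn mpolyX0 addr0.
Qed.

(* On concrete differential polynomials, ssreflect's [rewrite], [apply:] and
   [done] may compare distinct products by unfolding them and diverge; hence the
   explicit chains of [etrans] below. *)
Lemma flow_der p : flow (der p) = lieD (flow p).
Proof.
elim/diffpoly_ind: p => [c|p q IHp IHq|p q IHp IHq|i j].
- by rewrite der_const raddf0 flowC /lieD !mderivC mul0r addr0.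
- rewrite (derD p q) (flowD p q) (flowD (der p) (der q)).
  exact (etrans (congr2 +%R IHp IHq) (esym (lieDD (flow p) (flow q)))).
- apply (etrans (congr1 flow (derM p q))).
  apply (etrans (flowD (der p * q) (p * der q))).
  apply (etrans (congr2 +%R (flowM (der p) q) (flowM p (der q)))).
  apply (etrans (congr2 (fun a b => a * flow q + flow p * b) IHp IHq)).
  exact (esym (etrans (congr1 _ (flowM p q)) (lieDM (flow p) (flow q)))).
apply (etrans (congr1 flow (der_dX R i j))).
exact (etrans (flow_dX i j.+1)
  (etrans (flow_var_succ i j) (esym (congr1 (@lieD R) (flow_dX i j))))).
Qed.

End Specialisation.

(** * The embedding of polynomials in x, y and the chain rule *)

Lemma mpoly_ring_ind (n : nat) (R : comNzRingType) (K : mpoly n R -> Prop) :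
    (forall c, K c%:MP) ->
    (forall p q, K p -> K q -> K (p + q)) ->
    (forall p q, K p -> K q -> K (p * q)) ->
    (forall i, K 'X_i) ->
  forall p, K p.
Proof.
move=> KC KD KM KX; elim/mpolyind => [|c m p _ _ Kp]; first by rewrite -mpolyC0.
apply: KD => //; rewrite -mul_mpolyC; apply: (KM) => //.
rewrite mpolyXE_id; elim/big_rec: _ => [|i q _ Kq]; first by rewrite -mpolyC1.
apply: (KM) => //; elim: (m i) => [|k IHk]; first by rewrite expr0 -mpolyC1.
by rewrite exprS; apply: (KM).
Qed.

(** Both sides obey the sum and product rules in Q, so agreement on constants and variables
    suffices. *)
Lemma mmap_chain_rule (n : nat) (R S : comNzRingType) (f : {rmorphism R -> S})
    (h : 'I_n -> S) (D : S -> S) :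
    (forall a b, D (a + b) = D a + D b) ->
    (forall a b, D (a * b) = D a * b + a * D b) ->
    (forall c, D (f c) = 0) ->
  forall Q, D (mmap f h Q) = \sum_i mmap f h Q^`M(i) * D (h i).
Proof.
move=> DD DM Df; elim/mpoly_ring_ind => [c|p q IHp IHq|p q IHp IHq|j].
- rewrite mmapC Df big1 // => i _.
  by rewrite mderivC raddf0 mul0r.
- rewrite raddfD /= DD IHp IHq -big_split; apply: eq_bigr => i _.
  by rewrite /= linearD raddfD mulrDl.
- rewrite rmorphM /= DM IHp IHq mulr_suml mulr_sumr -big_split /=.
  apply: eq_bigr => i _; rewrite mderivM rmorphD !rmorphM /=; ring.
rewrite mmapX mmap1U (bigD1 j) //= big1 => [|i ij].
  rewrite mderivX mnm1E eqxx scale1r.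
  by rewrite mnm_subnn mpolyX0 rmorph1 mul1r addr0.
by rewrite mderivX mnm1E eq_sym (negbTE ij) scale0r raddf0 mul0r.
Qed.

Lemma to_diffpolyD Q T : to_diffpoly (Q + T) = to_diffpoly Q + to_diffpoly T.
Proof. exact: raddfD. Qed.

Lemma to_diffpolyM Q T : to_diffpoly (Q * T) = to_diffpoly Q * to_diffpoly T.
Proof. exact: rmorphM. Qed.

Lemma to_diffpolyC c : to_diffpoly c%:MP = mkmalgU mone c.
Proof.
rewrite /to_diffpoly mmapC.
exact (etrans (esym (monalg.mul_malgC c (1 : diffpoly rat))) (mulr1 _)).
Qed.

Lemma to_diffpolyX i : to_diffpoly 'X_i = dX rat i 0.
Proof. by rewrite /to_diffpoly mmapX mmap1U. Qed.

Lemma flow_to_diffpoly Q : flow (to_diffpoly Q) = Q.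
Proof.
elim/mpoly_ring_ind: Q => [c|Q T IHQ IHT|Q T IHQ IHT|i].
- exact (etrans (congr1 (@flow _) (to_diffpolyC c)) (flowC c)).
- exact (etrans (congr1 (@flow _) (to_diffpolyD Q T))
    (etrans (flowD _ _) (congr2 +%R IHQ IHT))).
- exact (etrans (congr1 (@flow _) (to_diffpolyM Q T))
    (etrans (flowM _ _) (congr2 *%R IHQ IHT))).
apply (etrans (congr1 (@flow _) (to_diffpolyX i))).
apply (etrans (flow_dX _ i 0)).
by case: (ord2P i) => ->.
Qed.

Lemma der_to_diffpoly (Q : mpoly 2 rat) :
  der (to_diffpoly Q) = to_diffpoly (Q^`M(ord0)) * dX rat ord0 1
    + to_diffpoly (Q^`M(ord_max)) * dX rat ord_max 1.
Proof.
have derA c : der (in_alg (diffpoly rat) c) = 0.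
  have <- := der_const c; congr der.
  by rewrite -to_diffpolyC /to_diffpoly mmapC.
apply (etrans (mmap_chain_rule (fun i => dX rat i 0) (@derD rat) (@derM rat) derA Q)).
rewrite big_ord_recl big_ord1.
have -> : lift ord0 ord0 = ord_max :> 'I_2 by apply: val_inj.
exact (congr2 (fun a b => _ * a + _ * b) (der_dX rat ord0 0) (der_dX rat ord_max 0)).
Qed.

(** Explicit cofactors for the congruence of L and [der] modulo x' - 1 and y' - y; they make the
    preimage of a differential ideal containing both stable under L. *)
Lemma to_diffpoly_lieD (Q : mpoly 2 rat) :
  to_diffpoly (lieD Q) = der (to_diffpoly Q)
    + (- to_diffpoly (Q^`M(ord0)) * (dX rat ord0 1 - 1)
       + - to_diffpoly (Q^`M(ord_max)) * (dX rat ord_max 1 - dX rat ord_max 0)).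
Proof.
have eliminate (S : comNzRingType) (a b x1 y0 y1 : S) :
    a + b * y0 = (a * x1 + b * y1) + (- a * (x1 - 1) + - b * (y1 - y0)).
  by ring.
apply (etrans (to_diffpolyD _ _)).
apply (etrans (congr1 (fun z => _ + z) (to_diffpolyM _ _))).
apply (etrans (congr1 (fun z => _ + _ * z) (to_diffpolyX ord_max))).
exact (etrans (eliminate _ _ _ _ _ _)
  (congr1 (fun z => z + _) (esym (der_to_diffpoly Q)))).
Qed.

(** * Membership and non-membership of 1 *)

Notation flow_gens P :=
  [:: dX rat ord0 1 - 1; dX rat ord_max 1 - dX rat ord_max 0; to_diffpoly P].
Notation flow_ideal P := (ideal_of_seq (flow_gens P)).

Lemma mem_seq3P (T : eqType) (u a b c : T) :
  reflect [\/ u = a, u = b | u = c] (u \in [:: a; b; c]).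
Proof.
rewrite !inE; apply: (iffP or3P).
  by case=> /eqP; [constructor 1|constructor 2|constructor 3].
by case=> ->; rewrite eqxx; [constructor 1|constructor 2|constructor 3].
Qed.

Lemma ideal_of_seq_gen (R : comNzRingType) (s : seq R) a : a \in s -> ideal_of_seq s a.
Proof.
move=> sa; exists [:: (1, a)]; last by rewrite big_seq1 mul1r.
by move=> c; rewrite inE => /eqP ->.
Qed.

Lemma one_in_differential_ideal s (P : mpoly 2 rat) :
    supported (rcons s 0%N) P -> vanishes (size s) P -> P != 0 ->
  generated_differential_ideal (flow_ideal P) 1.
Proof.
move=> sP vP P0 J [_ JD JM Jder] JI.
have Jgen a : a \in flow_gens P -> J a by move=> sa; apply/JI/ideal_of_seq_gen.
have J1 : J (dX rat ord0 1 - 1) by apply/Jgen/mem_seq3P; constructor 1.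
have J2 : J (dX rat ord_max 1 - dX rat ord_max 0).
  by apply/Jgen/mem_seq3P; constructor 2.
have J3 : J (to_diffpoly P) by apply/Jgen/mem_seq3P; constructor 3.
have : J (to_diffpoly 1); last by rewrite -mpolyC1 to_diffpolyC.
apply: (one_in_stable (W := fun T => J (to_diffpoly T)) _ _ sP vP P0 J3).
  move=> T JT; rewrite to_diffpoly_lieD.
  exact (JD _ _ (Jder _ JT) (JD _ _ (JM _ _ J1) (JM _ _ J2))).
move=> c T1 T2 JT1 JT2; rewrite -mul_mpolyC to_diffpolyD to_diffpolyM.
exact (JD _ _ (JM _ _ JT1) JT2).
Qed.

Lemma flow_iter_der j p : flow (iter j (@der rat) p) = iter j (@lieD rat) (flow p).
Proof.
elim: j => [//|j IHj].
exact (etrans (flow_der _) (congr1 (@lieD rat) IHj)).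
Qed.

Lemma flow_sum (I : Type) (s : seq I) (F : I -> diffpoly rat) :
  flow (\sum_(i <- s) F i) = \sum_(i <- s) flow (F i).
Proof. exact: raddf_sum. Qed.

(** [flow] kills the first two generators and sends the third to P. *)
Lemma flow_flow_ideal P a : flow_ideal P a -> exists T, flow a = T * P.
Proof.
case=> s sP ->; rewrite flow_sum.
elim: s sP => [|c s IHs] sP; first by exists 0; rewrite big_nil mul0r.
have [|T eT] := IHs; first by move=> e es; apply: sP; rewrite in_cons es orbT.
have [U eU] : exists U, flow c.2 = U * P.
  have /mem_seq3P [->|->|->] := sP c (mem_head _ _).
  - exists 0; rewrite mul0r; apply (etrans (flowB _ _)).
    apply (etrans (congr2 (fun a b => a - b) (flow_dX rat ord0 1) (flow1 rat))).
    exact: subrr.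
  - exists 0; rewrite mul0r; apply (etrans (flowB _ _)).
    apply (etrans (congr2 (fun a b => a - b)
      (flow_dX rat ord_max 1) (flow_dX rat ord_max 0))).
    exact: subrr.
  - by exists 1; rewrite flow_to_diffpoly mul1r.
exists (flow c.1 * U + T).
rewrite big_cons eT mulrDl -mulrA -eU.
exact (congr1 (fun z => z + _) (flowM _ _)).
Qed.

(** [flow] sends the j-th derivative of an element of the ideal to some L^j (T P), which is 0 at (0,
    1) for j up to h; a relation for 1 would give 1 = 0. *)
Lemma one_notin_prolonged_ideal h P :
  vanishes h.+1 P -> ~ prolonged_ideal h (flow_ideal P) 1.
Proof.
move=> vP [s sP one].
have := congr1 (@evp rat) (etrans (esym (flow1 rat))
  (etrans (congr1 (@flow rat) one) (flow_sum _ _))).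
have -> : evp 1 = 1 :> rat by exact: meval1.
have -> : evp (\sum_(c <- s) flow (c.1 * c.2))
    = \sum_(c <- s) evp (flow (c.1 * c.2)) :> rat.
  exact: raddf_sum.
rewrite big_seq big1 => [/eqP|c cs]; first by rewrite oner_eq0.
have [a [j [Ia jh ->]]] := sP c cs.
have [T eT] := flow_flow_ideal Ia.
apply (etrans (congr1 (@evp rat) (flowM c.1 (iter j der a)))).
apply (etrans (evpM _ _)).
have e2 := etrans (flow_iter_der j a) (congr1 (iter j (@lieD rat)) eT).
apply (etrans (congr1 (fun z => _ * evp z) e2)).
by rewrite (vanishesMl T vP jh) mulr0.
Qed.

Theorem proposition1 (d : nat) (hd : (0 < d)%N) :
  let B := ('C(d + 2, 2) - 1)%N in
  exists P : mpoly 2 rat,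
    let I := ideal_of_seq [:: x_ 1 - 1; y_ 1 - y_ 0; to_diffpoly P] in
    [/\ irreducible_elt P,
        (msize P <= d.+1)%N,
        generated_differential_ideal I 1
      & ~ prolonged_ideal (B - 1)%N I 1].
Proof.
move=> B.
have BE : B = size (mult_seq d).
  by have := size_mult_seq d; have := binomial_bound d; rewrite /B; lia.
have B0 : (0 < B)%N by rewrite BE; have := size_mult_seq d; nia.
(* The subtraction in [B] is truncated; [B0] ensures that [B] is strictly below the binomial
   coefficient. *)
have [|P P0 [Pd vP]] := @exists_vanishing rat B d; first by rewrite /B in B0 *; lia.
have vs : vanishes (size (mult_seq d)) P by rewrite -BE.
exists P; split=> //.
- exact: irreducible_of_vanishing hd P0 Pd vs.
- exact: one_in_differential_ideal (supported_mult_seq Pd) vs P0.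
(* Derivatives of order at most B - 1 use exactly the B conditions on P. *)
- by apply: one_notin_prolonged_ideal; rewrite subn1 prednK.
Qed.
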